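(* The elements of $\varnothing^{\oplus}$ (where $\varnothing$ is the empty sequence) are exactly: (i) $(1)$; (ii) $(0,x)$ where $x\in\mathbb{Z}\setminus\{-1\}$; (iii) $(x,0)$ where $x\in\mathbb{Z}\setminus\{-1\}$; (iv) $(X,x,0,y,Y)$, where $(X,Y)\in E$ and $x,y\in\mathbb{Z}\setminus\{-1\}$ satisfy $x+y=-1$. If $M=(m_1,\dots,m_k)\neq\varnothing$ is a minimal element of $\mathbb{Z}^*$, the elements of $M^{\oplus}$ are exactly: (1)(a) $(0,x,m_1,\dots,m_k)$, for all $x\in\mathbb{Z}\setminus\{-1\}$; (1)(b) the unique minimal sequence obtained by blowing-down $(0,-1,m_1,\dots,m_k)$; (2)(a) $(m_1,\dots,m_k,x,0)$, for all $x\in\mathbb{Z}\setminus\{-1\}$; (2)(b) the unique minimal sequence obtained by blowing-down $(m_1,\dots,m_k,-1,0)$; (3) for each $j\in\{1,\dots,k\}$: (a) $(m_1,\dots,m_{j-1},x,0,y,m_{j+1},\dots,m_k)$, for all $x,y\in\mathbb{Z}\setminus\{-1\}$ satisfying $x+y=m_j$; (b) the unique minimal sequence obtained by blowing-down $(m_1,\dots,m_{j-1},-1,0,m_j+1,m_{j+1},\dots,m_k)$; (c) the unique minimal sequence obtained by blowing-down $(m_1,\dots,m_{j-1},m_j+1,0,-1,m_{j+1},\dots,m_k)$; (4)(a) $(X,x,0,y,Y,m_2,\dots,m_k)$, for all $x,y\in\mathbb{Z}\setminus\{-1\}$ satisfying $x+y=-1$ and all $(X,Y)\in E^{m_1}$;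 (4)(b) $(m_1,\dots,m_{i-1},X,x,0,y,Y,m_{i+2},\dots,m_k)$, for all $x,y\in\mathbb{Z}\setminus\{-1\}$ satisfying $x+y=-1$, all $i$ such that $1\le i<k$, and all $(X,Y)\in{}^{m_i}\!E^{m_{i+1}}$; (4)(c) $(m_1,\dots,m_{k-1},X,x,0,y,Y)$, for all $x,y\in\mathbb{Z}\setminus\{-1\}$ satisfying $x+y=-1$ and all $(X,Y)\in{}^{m_k}\!E$.
   Context: $\mathbb{Z}^*$ is the set of finite sequences of integers, including the empty sequence $\varnothing$. Nested sequences denote concatenation; $X^-$ is the reversal of $X$. The blowings-up of a nonempty $X=(x_1,\dots,x_n)$ are $(-1,x_1-1,x_2,\dots,x_n)$, $(x_1,\dots,x_{i-1},x_i-1,-1,x_{i+1}-1,x_{i+2},\dots,x_n)$ for $1\le i<n$, and $(x_1,\dots,x_{n-1},x_n-1,-1)$; also $(-1)$ is the blowing-up of $\varnothing$. Blowing-down is the inverse (it is performed at a term equal to $-1$, which is deleted while its neighbouring terms increase by $1$). $\sim$ is the equivalence relation on $\mathbb{Z}^*$ generated by blowing-up; $\le$ is the partial order generated by $X\le X'$ whenever $X'$ is a blowing-up of $X$. A sequence is minimal if it cannot be blown down, i.e. no term equals $-1$. For $B=(b_1,\dots,b_n)\in\mathbb{Z}^*$ and $x\in\mathbb{Z}$ put ${}_xB=(0,x,b_1,\dots,b_n)$ and $B_x=(b_1,\dots,b_n,x,0)$; if $B\ne\varnothing$, $1\le i\le n$ and $x+y=b_i$ put $B_{(i;x,y)}=(b_1,\dots,b_{i-1},x,0,y,b_{i+1},\dots,b_n)$.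 For a minimal sequence $M=(m_1,\dots,m_k)$, $M^{\oplus}$ is the set of sequences $Z$ obtained in one of the following ways: (1) pick $x\in\mathbb{Z}$ and let $Z$ be the unique minimal sequence with $Z\le{}_xM$; (2) pick $x\in\mathbb{Z}$ and let $Z$ be the unique minimal sequence with $Z\le M_x$; (3) if $M\ne\varnothing$, pick $j\in\{1,\dots,k\}$ and $x,y\in\mathbb{Z}$ with $x+y=m_j$, and let $Z$ be the unique minimal sequence with $Z\le M_{(j;x,y)}$; (4) pick $M'=(\mu_1,\dots,\mu_\ell)\ge M$ having exactly one term $\mu_j$ equal to $-1$, pick $x,y\in\mathbb{Z}\setminus\{-1\}$ with $x+y=-1$, and let $Z=M'_{(j;x,y)}$. Let $\mathcal{N}=\{x\in\mathbb{Z}:x<-1\}$ and let $\mathcal{N}^*$ be the set of finite sequences in $\mathcal{N}$ (including $\varnothing$). Let $\mathcal{M}$ be the set of nonempty sequences $(x_1,\dots,x_n)$ with $x_1\ne-1$ and $x_i\le-2$ for all $i>1$, and $\mathcal{M}^-=\{X^-:X\in\mathcal{M}\}$. Say that $Z$ can be $(+,-)$-contracted (resp. $(-,+)$-contracted, $(+,+)$-contracted) to $Z'$ if there is a sequence of blowings-down which transforms $Z$ into $Z'$ and such that no blowing-down is performed at the leftmost (resp. rightmost, leftmost or rightmost) term of a sequence. For $\alpha,\beta\in\mathbb{Z}$ define - $E=\{(X,Y)\in\mathcal{N}^*\times\mathcal{N}^*:(X,-1,Y)\sim\varnothing\}$; - ${}^{\alpha}\!E=\{(X,Y)\in\mathcal{M}\times\mathcal{N}^*:(X,-1,Y)\text{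 can be }(+,-)\text{-contracted to }(\alpha)\}$; - $E^{\alpha}=\{(X,Y)\in\mathcal{N}^*\times\mathcal{M}^-:(X,-1,Y)\text{ can be }(-,+)\text{-contracted to }(\alpha)\}$; - ${}^{\alpha}\!E^{\beta}=\{(X,Y)\in\mathcal{M}\times\mathcal{M}^-:(X,-1,Y)\text{ can be }(+,+)\text{-contracted to }(\alpha,\beta)\}$. *)

(* Defs.v *)
From mathcomp Require Import all_boot all_order all_algebra.
From Stdlib Require Import Relation_Operators.
Set Implicit Arguments.
Unset Strict Implicit.
Unset Printing Implicit Defensive.
Import Order.TTheory GRing.Theory Num.Theory.
Local Open Scope ring_scope.

(* [blowup i X X']: X' is a blowing-up of X whose new term -1 is the i-th term
   of X' (counted from 0); equivalently, X is obtained from X' by a blowing-down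
   performed at its i-th term. The position is recorded because (+,-)-, (-,+)-
   and (+,+)-contractions restrict where blowings-down are performed. *)
Inductive blowup : nat -> seq int -> seq int -> Prop :=
| blowup_nil : blowup 0 [::] [:: -1]
| blowup_left (x : int) (s : seq int) :
    blowup 0 (x :: s) [:: -1, x - 1 & s]
| blowup_mid (s : seq int) (x y : int) (t : seq int) :
    blowup (size s).+1 (s ++ [:: x, y & t]) (s ++ [:: x - 1, -1, y - 1 & t])
| blowup_right (s : seq int) (x : int) :
    blowup (size s).+1 (s ++ [:: x]) (s ++ [:: x - 1; -1]).

Definition is_blowup (X X' : seq int) : Prop := exists i, blowup i X X'.

Definition equivZ : seq int -> seq int -> Prop :=
  clos_refl_sym_trans (seq int) is_blowup.

Definition leZ : seq int -> seq int -> Prop :=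
  clos_refl_trans (seq int) is_blowup.

Definition minimal (X : seq int) : Prop := -1 \notin X.

(* Z is the unique minimal sequence below X. Uniqueness fails for some X, such
   as (0,-1,-1); [min_below_L], [min_below_R] and [min_below_I] show that Z
   exists in all the cases where the notion is used below. *)
Definition is_min_below (X Z : seq int) : Prop :=
  unique (fun W => minimal W /\ leZ W X) Z.

Definition addL (x : int) (B : seq int) : seq int := [:: 0, x & B].

Definition addR (B : seq int) (x : int) : seq int := B ++ [:: x; 0].

(* B_(j+1; x, y): positions are counted from 0. Only used with
   j < size B and x + y = B`_j. *)
Definition addI (B : seq int) (j : nat) (x y : int) : seq int :=
  take j B ++ [:: x; 0; y] ++ drop j.+1 B.

Inductive oplus (M : seq int) : seq int -> Prop :=
| oplus1 (x : int) (Z : seq int) :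
    is_min_below (addL x M) Z -> oplus M Z
| oplus2 (x : int) (Z : seq int) :
    is_min_below (addR M x) Z -> oplus M Z
| oplus3 (j : nat) (x y : int) (Z : seq int) :
    (j < size M)%N -> x + y = M`_j ->
    is_min_below (addI M j x y) Z -> oplus M Z
| oplus4 (M' : seq int) (j : nat) (x y : int) :
    leZ M M' -> count_mem (-1) M' = 1%N ->
    (j < size M')%N -> M'`_j = -1 ->
    x != -1 -> y != -1 -> x + y = -1 ->
    oplus M (addI M' j x y).

Definition inNstar (X : seq int) : bool := all (fun x => x < -1) X.

Definition inM (X : seq int) : bool :=
  if X is x :: s then (x != -1) && all (fun z => z <= -2) s else false.

Definition inMrev (X : seq int) : bool := inM (rev X).

(* [contracts l r Z Z']: Z is transformed into Z' by blowings-down, none of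
   which is performed at a leftmost term if l, nor at a rightmost term if r. *)
Definition contract_step (l r : bool) (W W' : seq int) : Prop :=
  exists i, [/\ blowup i W' W, l -> i <> 0%N & r -> i <> (size W).-1].

Definition contracts (l r : bool) : seq int -> seq int -> Prop :=
  clos_refl_trans (seq int) (contract_step l r).

Definition E_ (X Y : seq int) : Prop :=
  [/\ inNstar X, inNstar Y & equivZ (X ++ -1 :: Y) [::]].

Definition E_left (alpha : int) (X Y : seq int) : Prop :=
  [/\ inM X, inNstar Y & contracts true false (X ++ -1 :: Y) [:: alpha]].

Definition E_right (beta : int) (X Y : seq int) : Prop :=
  [/\ inNstar X, inMrev Y & contracts false true (X ++ -1 :: Y) [:: beta]].

Definition E_both (alpha beta : int) (X Y : seq int) : Prop :=
  [/\ inM X, inMrev Y & contracts true true (X ++ -1 :: Y) [:: alpha; beta]].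

(* Existence of the unique minimal sequence below a sequence L^-, a, R with
   a >= 0 in which only the terms adjacent to a may be equal to -1: this shape
   is preserved by blowing-down, and [contracted] is an explicit normal form. *)
Definition bump (S : seq int) : seq int := if S is r :: t then r + 1 :: t else [::].

Lemma blowup_inv i W X : blowup i W X ->
  exists P B, X = rev P ++ -1 :: B /\ W = rev (bump P) ++ bump B.
Proof.
case=> [|x s|s x y t|s x].
- by exists [::], [::].
- by exists [::], (x - 1 :: s); rewrite /= subrK.
- exists (x - 1 :: rev s), (y - 1 :: t).
  by rewrite /= !rev_cons !revK !cat_rcons !subrK.
- exists (x - 1 :: rev s), [::].
  by rewrite /= !rev_cons !revK !cat_rcons subrK.
Qed.

Lemma blow_down P B : is_blowup (rev (bump P) ++ bump B) (rev P ++ -1 :: B).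
Proof.
case: P B => [|p P] [|b B] /=.
- by exists 0%N; constructor.
- by exists 0%N; rewrite -{2}(addrK 1 b); constructor.
- exists (size (rev P)).+1; rewrite !rev_cons cats0 -!cats1 -catA /=.
  by rewrite -{2}(addrK 1 p); constructor.
- exists (size (rev P)).+1; rewrite !rev_cons -!cats1 -!catA /=.
  by rewrite -{2}(addrK 1 p) -{2}(addrK 1 b); constructor.
Qed.

Definition side (S : seq int) : bool := -1 \notin behead S.

Fixpoint strip (S : seq int) (c : int) : int * seq int :=
  if S is r :: t then
    if r + c == -1 then ((strip t 1).1 + 1, (strip t 1).2) else (0, r + c :: t)
  else (0, [::]).

Definition contracted (L : seq int) (a : int) (R : seq int) : seq int :=
  rev (strip L 0).2 ++ a + (strip L 0).1 + (strip R 0).1 :: (strip R 0).2.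

Lemma strip_down S : strip (-1 :: S) 0 = ((strip (bump S) 0).1 + 1, (strip (bump S) 0).2).
Proof. by case: S => //= r t; rewrite addr0. Qed.

Lemma strip_minimal S : minimal S -> strip S 0 = (0, S).
Proof.
by case: S => //= r t; rewrite /minimal inE negb_or eq_sym addr0 => /andP[/negPf-> _].
Qed.

Lemma side_down S : side (-1 :: S) -> side (bump S).
Proof. by case: S => //= r t; rewrite /side /= inE negb_or => /andP[]. Qed.

Lemma contracted_downl L a R : contracted (bump L) (a + 1) R = contracted (-1 :: L) a R.
Proof. by rewrite /contracted strip_down /=; congr (_ ++ _ + _ :: _); rewrite -addrA [1 + _]addrC. Qed.

Lemma contracted_downr L a R : contracted L (a + 1) (bump R) = contracted L a (-1 :: R).
Proof.
rewrite /contracted strip_down /=; congr (_ ++ _ :: _).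
by rewrite [_ + 1 in RHS]addrC !addrA [a + 1 + _]addrAC.
Qed.

Lemma split_at (L R P B : seq int) (a : int) : 0 <= a ->
  rev L ++ a :: R = rev P ++ -1 :: B ->
  (exists C, L = C ++ -1 :: P /\ B = rev C ++ a :: R) \/
  (exists C, R = C ++ -1 :: B /\ P = rev C ++ a :: L).
Proof.
move=> a0; elim/last_ind: L P => [|L l IH] P; case/lastP: P => [|P p] /=.
- by case=> ea; rewrite ea in a0.
- rewrite rev_rcons /= => -[<- ->]; right; exists (rev P); split=> //.
  by rewrite revK cats1.
- rewrite rev_rcons /= => -[-> <-]; left; exists L; split; first by rewrite cats1.
  by [].
- rewrite !rev_rcons /= => -[<- /IH[[C [-> ->]]|[C [-> ->]]]].
  + by left; exists C; rewrite rcons_cat.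
  + by right; exists C; rewrite rcons_cat.
Qed.

Lemma side_split C P : side (C ++ -1 :: P) -> C = [::].
Proof. by case: C => //= c C; rewrite /side /= mem_cat inE eqxx orbT. Qed.

Definition core_shape (L : seq int) (a : int) (R : seq int) (X : seq int) : Prop :=
  [/\ side L, side R, 0 <= a & X = rev L ++ a :: R].

Lemma shape_blowup W X L a R : is_blowup W X -> core_shape L a R X ->
  exists L' a' R', core_shape L' a' R' W /\ contracted L' a' R' = contracted L a R.
Proof.
case=> i /blowup_inv[P [B [-> ->]]] [sL sR a0 /esym/split_at] /(_ a0).
have a1 : 0 <= a + 1 by rewrite addr_ge0.
case=> -[C [eC ->]].
- have eC0 : C = [::] by move: sL; rewrite eC => /side_split.
  move: sL; rewrite eC eC0 /= => sL; exists (bump P), (a + 1), R.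
  by split; [split=> //; exact: side_down|exact: contracted_downl].
- have eC0 : C = [::] by move: sR; rewrite eC => /side_split.
  move: sR; rewrite eC eC0 /= => sR; exists L, (a + 1), (bump B).
  split; last exact: contracted_downr.
  by split=> //; [exact: side_down|rewrite rev_cons cat_rcons].
Qed.

Lemma shape_leZ W X L a R : leZ W X -> core_shape L a R X ->
  exists L' a' R', core_shape L' a' R' W /\ contracted L' a' R' = contracted L a R.
Proof.
move=> leWX; elim: leWX L a R => {W X} [W X WX|X|W V X _ IH1 _ IH2] L a R.
- exact: shape_blowup.
- by exists L, a, R.
- move=> /IH2[L1 [a1 [R1 [/IH1[L2 [a2 [R2 [s2 e2]]]] e1]]]].
  by exists L2, a2, R2; rewrite e2.
Qed.

Lemma shape_minimal L a R X : core_shape L a R X -> minimal X -> X = contracted L a R.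
Proof.
case=> _ _ _ ->; rewrite /minimal mem_cat mem_rev inE !negb_or => /and3P[mL _ mR].
by rewrite /contracted !strip_minimal //= !addr0.
Qed.

Lemma leZ_minimal X : exists Z, minimal Z /\ leZ Z X.
Proof.
have [n] := ubnP (size X); elim: n X => // n IH X.
have [|mX _] := boolP (-1 \in X); last by exists X; split=> //; constructor 2.
case/splitPr=> p1 p2; rewrite -(revK p1) ltnS => ltn.
have [|Z [mZ leZX]] := IH (rev (bump (rev p1)) ++ bump p2).
  apply: leq_trans ltn; rewrite !size_cat !size_rev /= addnS ltnS.
  by apply: leq_add; [rewrite -(size_rev p1); case: (rev p1)|case: p2].
exists Z; split=> //; apply: rt_trans leZX _; apply: rt_step.
exact: blow_down.
Qed.

Lemma shape_min_below L a R X : core_shape L a R X -> exists Z, is_min_below X Z.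
Proof.
move=> sX; have [Z [mZ leX]] := leZ_minimal X; exists Z; split=> // Z' [mZ' leX'].
have [L1 [a1 [R1 [s1 e1]]]] := shape_leZ leX sX.
have [L2 [a2 [R2 [s2 e2]]]] := shape_leZ leX' sX.
by rewrite (shape_minimal s1 mZ) (shape_minimal s2 mZ') e1.
Qed.

Lemma min_below_L M x : minimal M -> exists Z, is_min_below (addL x M) Z.
Proof. by move=> mM; apply: (@shape_min_below [::] 0 (x :: M)). Qed.

Lemma min_below_R M x : minimal M -> exists Z, is_min_below (addR M x) Z.
Proof.
move=> mM; apply: (@shape_min_below (x :: rev M) 0 [::]); split=> //.
  by rewrite /side /= mem_rev.
by rewrite rev_cons revK cat_rcons.
Qed.

Lemma min_below_I M j x y : minimal M -> exists Z, is_min_below (addI M j x y) Z.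
Proof.
move=> mM; apply: (@shape_min_below (x :: rev (take j M)) 0 (y :: drop j.+1 M)).
split=> //.
- by rewrite /side /= mem_rev; apply: contra mM => /mem_take.
- by rewrite /side /=; apply: contra mM => /mem_drop.
- by rewrite rev_cons revK cat_rcons.
Qed.

(* Main.v *)
Require Import Defs.
From mathcomp Require Import all_boot all_order all_algebra.
From mathcomp Require Import zify ring.
From Stdlib Require Import Relation_Operators Operators_Properties.
Set Implicit Arguments.
Unset Strict Implicit.
Unset Printing Implicit Defensive.
Import Order.TTheory GRing.Theory Num.Theory.
Local Open Scope ring_scope.

(** Apart from family (4) of [oplus] the equivalences are a matter of unfolding:
    a sequence with no term -1 is the only sequence below itself, and for the
    remaining choices x = -1 or y = -1 both sides speak of the same minimal
    sequence, which is (1) when M is empty.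

    Family (4) asks for all sequences (P, -1, Q) above M in which P and Q have
    no term -1.  A blowing-up inserts its new term in one of the gaps of M
    (before m_1, between two consecutive terms, after m_k) and only decreases
    the terms next to it.  So, at any term m of M = (A, m, B), a sequence above
    M splits into a part obtained from (A, m) and a part obtained from (m, B),
    neither of which uses a blowing-up at the end carrying m, and the two
    decrements of m add up ([contracts_split]).  A part that is not trivial
    contains a term -1 away from the position of m, so when -1 occurs only once one
    of the two parts is trivial ([one_sided]).  Walking along M, all the
    blowings-up are seen to happen in a single gap ([gap_of_leZ]), and what
    happens in that gap is a contraction of the kind defining E_right, E_both
    or E_left.

    The sign conditions in these sets come from the same splitting: removing
    the protected end terms from a cluster leaves a sequence above the empty
    one ([peel_left], [peel_right]), and all terms of such a sequence are
    negative ([leZ_nil_negative]).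

    The set E is defined by equivalence to the empty sequence rather than by
    the order.  To pass from one to the other, blow (X, -1, Y) down to a minimal
    sequence Z.  Blowing-up preserves the fact that the prefix determinants of
    the negated tridiagonal matrix of a sequence are positive and that its full
    determinant is 1.  For Z this forces all terms to be at most -2, the prefix
    determinants then increase strictly from 1, and Z is empty
    ([equivZ_nil_leZ]). *)

(** * Contraction steps *)

(** The flags of [contract_step] simply forbid some of the four constructors of
    [blowup]; positions disappear in this form. *)
Variant contract_spec : bool -> bool -> seq int -> seq int -> Prop :=
| ContractNil : contract_spec false false [:: -1] [::]
| ContractLeft r x s : contract_spec false r [:: -1, x - 1 & s] (x :: s)
| ContractMid l r s x y t :
    contract_spec l r (s ++ [:: x - 1, -1, y - 1 & t]) (s ++ [:: x, y & t])
| ContractRight l s x : contract_spec l false (s ++ [:: x - 1; -1]) (s ++ [:: x]).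

Lemma contract_stepP l r W V : contract_step l r W V <-> contract_spec l r W V.
Proof.
split.
  case=> i [b]; case: i V W / b => [|x s|s x y t|s x] hl hr.
  - by case: l hl => [/(_ isT)//|_]; case: r hr => [/(_ isT)//|_]; constructor.
  - by case: l hl => [/(_ isT)//|_]; constructor.
  - by constructor.
  - by case: r hr => [/(_ isT)[]|_]; [rewrite size_cat addn2|constructor].
case=> {l r W V} [|r x s|l r s x y t|l s x].
- by exists 0%N; split=> //; constructor.
- by exists 0%N; split=> //; constructor.
- exists (size s).+1; split=> //; first by constructor.
  by move=> _; rewrite size_cat /=; lia.
- by exists (size s).+1; split=> //; constructor.
Qed.

Lemma cat_eq_cat_cons (T : Type) (s1 s2 A B : seq T) (m : T) :
  s1 ++ s2 = A ++ m :: B ->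
  (exists s, s1 = A ++ m :: s /\ B = s ++ s2) \/
  (exists s, A = s1 ++ s /\ s2 = s ++ m :: B).
Proof.
elim: s1 A => [|x s1 IH] [|a A] /=.
- by move=> ->; right; exists [::].
- by move=> ->; right; exists (a :: A).
- by case=> -> <-; left; exists s1.
- case=> -> /IH[[s [-> ->]]|[s [-> ->]]]; first by left; exists s.
  by right; exists s.
Qed.

(** * Splitting a contraction at a term *)

(** The term m never disappears, and each blowing-up lies on one side of it.
    The last clause of each alternative is stated for every c because the other
    side changes the value of m independently, and only differences matter.
    The middle clause forgets m altogether: a term inserted next to m becomes a
    term inserted at an end of A or B, which is then allowed. *)
Lemma contract_step_split l r W A m B : contract_step l r W (A ++ m :: B) ->
  (exists A' d, [/\ W = A' ++ m + d :: B, contract_step l false A' A &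
     forall c, contract_step l true (A' ++ [:: c + d]) (A ++ [:: c])]) \/
  (exists d B', [/\ W = A ++ m + d :: B', contract_step false r B' B &
     forall c, contract_step true r (c + d :: B') (c :: B)]).
Proof.
move=> /contract_stepP; move eV: (A ++ m :: B) => V h.
case: h eV => {l r W V} [|r x s|l r s x y t|l s x].
- by case: A.
- case: A => [|a A] /= [-> eB]; left.
    exists [:: -1], (-1); rewrite eB.
    by split=> // [|c]; apply/contract_stepP; constructor.
  exists [:: -1, x - 1 & A], 0; rewrite -eB addr0; split=> // [|c].
    by apply/contract_stepP; constructor.
  by rewrite addr0; apply/contract_stepP; constructor.
- move=> eV; case: (cat_eq_cat_cons (esym eV)) => [[s' [-> ->]]|[[|x' [|y' s']] [-> /=]]].
  + right; exists 0, (s' ++ [:: x - 1, -1, y - 1 & t]); rewrite addr0 -catA.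
    split=> // [|c]; first by apply/contract_stepP; constructor.
    by rewrite addr0; apply/contract_stepP/(ContractMid _ _ (c :: s')).
  + case=> <- <-; right; exists (-1), [:: -1, y - 1 & t]; rewrite cats0.
    split=> // [|c]; apply/contract_stepP; first by constructor.
    exact: (ContractMid _ _ [::]).
  + case=> <- <- <-; left; exists (s ++ [:: x - 1; -1]), (-1); rewrite -catA.
    split=> // [|c]; apply/contract_stepP; first by constructor.
    by rewrite -!catA; constructor.
  + case=> <- <- ->; left; exists (s ++ [:: x - 1, -1, y - 1 & s']), 0.
    rewrite -catA addr0; split=> // [|c]; apply/contract_stepP; first by constructor.
    by rewrite -!catA addr0; constructor.
- move=> eV; case: (cat_eq_cat_cons (esym eV)) => [[s' [-> ->]]|[[|x' [|y' s']] [-> //=]]].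
  + right; exists 0, (s' ++ [:: x - 1; -1]); rewrite addr0 -catA.
    split=> // [|c]; first by apply/contract_stepP; constructor.
    by rewrite addr0; apply/contract_stepP/(ContractRight _ (c :: s')).
  + case=> <- <-; right; exists (-1), [:: -1]; rewrite cats0.
    split=> // [|c]; apply/contract_stepP; first by constructor.
    exact: (ContractRight _ [::]).
Qed.

Lemma contracts_1n l r W V :
  contracts l r W V -> clos_refl_trans_1n _ (contract_step l r) W V.
Proof. exact: clos_rt_rt1n. Qed.

Lemma contracts_split l r W A m B : contracts l r W (A ++ m :: B) ->
  exists A' d e B', [/\ W = A' ++ m + d + e :: B',
     contracts l false A' A /\ contracts false r B' B,
     forall c, contracts l true (A' ++ [:: c + d]) (A ++ [:: c]) &
     forall c, contracts true r (c + e :: B') (c :: B)].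
Proof.
move/contracts_1n; move eV: (A ++ m :: B) => V h.
elim: h eV => {W V} [V <-|W1 W2 V st _ IH eV].
  exists A, 0, 0, B; rewrite !addr0.
  by split=> // [|c|c]; rewrite ?addr0; do ?split; exact: rt_refl.
have {IH eV}[A' [d [e [B' [eW [cA cB] cA' cB']]]]] := IH eV.
move: st; rewrite eW => /contract_step_split.
case=> [[A2 [f [-> st st']]]|[f [B2 [-> st st']]]].
- exists A2, (d + f), e, B'; split=> //.
  + by congr (_ ++ _ :: _); ring.
  + by split=> //; apply: rt_trans cA; exact: rt_step.
  + move=> c; rewrite addrA; apply: rt_trans (cA' c); exact: rt_step.
- exists A', d, (e + f), B2; split=> //.
  + by congr (_ ++ _ :: _); ring.
  + by split=> //; apply: rt_trans cB; exact: rt_step.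
  + move=> c; rewrite addrA; apply: rt_trans (cB' c); exact: rt_step.
Qed.

Lemma contracts_refl_or_mem l r W V : contracts l r W V -> W = V \/ -1 \in W.
Proof.
move/contracts_1n; case=> [|W2 V2 /contract_stepP st _]; first by left.
by right; case: st => *; rewrite ?mem_cat ?inE ?eqxx ?orbT.
Qed.

Lemma contract_spec_nil l r W : contract_spec l r W [::] -> ~~ (l || r).
Proof.
by move eV: [::] => V st; case: st eV => // [? ? []|? []].
Qed.

Lemma contracts_nil l r W : l || r -> contracts l r W [::] -> W = [::].
Proof.
move=> lr /contracts_1n; move eV: [::] => V h.
elim: h eV => {W V} // W1 W2 V /contract_stepP st _ IH eV.
by rewrite (IH eV) -eV in st; have := contract_spec_nil st; rewrite lr.
Qed.

Lemma contracts_leZ V W : contracts false false W V <-> leZ V W.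
Proof.
split; elim=> {V W} [W V|W|W U V _ IH1 _ IH2]; try by constructor 2.
- by case=> i [b _ _]; apply: rt_step; exists i.
- exact: rt_trans IH2 IH1.
- by case=> i b; apply: rt_step; exists i; split.
- exact: rt_trans IH2 IH1.
Qed.

(** In a proper growth the last term inserted is a -1, and choosing c = -d makes
    the term at the end equal to 0, so this -1 is elsewhere. *)
Lemma left_grown l A' d A : (forall c, contracts l true (A' ++ [:: c + d]) (A ++ [:: c])) ->
  A' = A /\ d = 0 \/ -1 \in A'.
Proof.
move/(_ (- d))/contracts_refl_or_mem; rewrite addNr mem_cat inE orbF.
case=> [/eqP|]; last by right.
by rewrite !cats1 eqseq_rcons => /andP[/eqP-> d0]; left; split=> //; apply/eqP; rewrite -oppr_eq0 eq_sym.
Qed.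

Lemma right_grown r d B' B : (forall c, contracts true r (c + d :: B') (c :: B)) ->
  B' = B /\ d = 0 \/ -1 \in B'.
Proof.
move/(_ (- d))/contracts_refl_or_mem; rewrite addNr inE /=.
case=> [[/eqP]|]; last by right.
by rewrite eq_sym oppr_eq0 => /eqP-> ->; left.
Qed.

(** Without its protected end term, a contraction is an unrestricted one: a
    blowing-up next to the protected term becomes a blowing-up at the end. *)
Lemma peel_left r U m B : contracts true r U (m :: B) ->
  exists a B', [/\ U = a :: B', contracts false r B' B & U = m :: B \/ -1 \in B'].
Proof.
case/(@contracts_split _ _ _ [::]) => A' [d [e [B' [-> [cA cB] cA' cB']]]].
have eA : A' = [::] by apply: contracts_nil cA.
have [[_ ed]|] := left_grown cA'; last by rewrite eA.
rewrite eA ed addr0 /=; exists (m + e), B'; split=> //.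
by case: (right_grown cB') => [[-> ->]|]; [rewrite addr0; left|right].
Qed.

Lemma peel_right l U A m : contracts l true U (A ++ [:: m]) ->
  exists A' b, [/\ U = A' ++ [:: b], contracts l false A' A &
    U = A ++ [:: m] \/ -1 \in A'].
Proof.
case/contracts_split => A' [d [e [B' [-> [cA cB] cA' cB']]]].
have eB : B' = [::] by apply: contracts_nil cB.
have [[_ ee]|] := right_grown cB'; last by rewrite eB.
rewrite eB ee addr0 /=; exists A', (m + d); split=> //.
by case: (left_grown cA') => [[-> ->]|]; [rewrite addr0; left|right].
Qed.

(** A flag is exactly what makes it harmless to add terms on that side. *)
Lemma contracts_in_context l r U V A B : contracts l r U V ->
  (l \/ A = [::]) -> (r \/ B = [::]) -> leZ (A ++ V ++ B) (A ++ U ++ B).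
Proof.
move=> h hA hB; apply/contracts_leZ; elim: h => {U V} [U V|U|U W V _ IH1 _ IH2].
- move=> /contract_stepP st; apply: rt_step; apply/contract_stepP.
  case: st hA hB => {l r U V} [|r x s|l r s x y t|l s x] hA hB.
  + by case: hA => // ->; case: hB => // ->; constructor.
  + by case: hA => // -> /=; constructor.
  + by rewrite -!catA /= !(catA A); constructor.
  + by case: hB => // ->; rewrite !cats0 !catA; constructor.
- exact: rt_refl.
- exact: rt_trans IH1 IH2.
Qed.

(** * Sequences above the empty sequence *)

Lemma leZ_nil_negative W : leZ [::] W -> all (fun z => z < 0) W.
Proof.
move/contracts_leZ/contracts_1n; move eV: [::] => V h.
elim: h eV => {W V} [V <- //|W1 W2 V /contract_stepP st _ IH /IH]; case: st => //.
- by move=> _ x s /= /andP[x0 ->]; rewrite andbT; lia.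
- move=> _ _ s x y t; rewrite !all_cat /= => /and4P[-> x0 y0 ->].
  by rewrite andbT; lia.
- by move=> _ s x; rewrite !all_cat /= !andbT => /andP[-> x0]; lia.
Qed.

(** With u = 0 and v = 1, the successive values of v are the determinants of the
    leading principal blocks of the tridiagonal matrix with diagonal -x_i and
    off-diagonal entries 1, by the three-term recurrence of continuants.  The
    predicate says that they are positive and that the last one is 1. *)
Fixpoint unimod (u v : int) (X : seq int) : bool :=
  if X is x :: t then (0 < - x * v - u) && unimod v (- x * v - u) t else v == 1.

(** Blowing up inserts one new determinant in the list, the sum of its two
    neighbours, as in a Farey sequence; hence positivity is not affected in
    either direction. *)
Lemma unimod_mid s x y t u v : 0 < v ->
  unimod u v (s ++ [:: x - 1, -1, y - 1 & t]) = unimod u v (s ++ [:: x, y & t]).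
Proof.
elim: s u v => [|z s IH] u v v0 /=; last first.
  by have [d0|//] := boolP (0 < - z * v - u); rewrite IH.
have -> : - -1 * (- (x - 1) * v - u) - v = - x * v - u by ring.
have -> : - (y - 1) * (- x * v - u) - (- (x - 1) * v - u) =
          - y * (- x * v - u) - v by ring.
have [d0|//] := boolP (0 < - x * v - u); last by rewrite andbF.
by have -> : 0 < - (x - 1) * v - u by lia.
Qed.

Lemma unimod_right s x u v : 0 < v ->
  unimod u v (s ++ [:: x - 1; -1]) = unimod u v (s ++ [:: x]).
Proof.
elim: s u v => [|z s IH] u v v0 /=; last first.
  by have [d0|//] := boolP (0 < - z * v - u); rewrite IH.
have -> : - -1 * (- (x - 1) * v - u) - v = - x * v - u by ring.
have [d0|//] := boolP (0 < - x * v - u); last by rewrite andbF.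
by have -> : 0 < - (x - 1) * v - u by lia.
Qed.

(** At the left end, the determinant inserted is a second copy of 1. *)
Lemma unimod_equivZ X Y : equivZ X Y -> unimod 0 1 X = unimod 0 1 Y.
Proof.
elim=> {X Y} [X Y [i b]|//|X Y _ ->//|X Y Z _ -> _ ->//].
case: b => [//|x s|s x y t|s x]; rewrite ?unimod_mid ?unimod_right //=.
have -> : - (x - 1) * (- -1 * 1 - 0) - 1 = - x * 1 - 0 by ring.
by [].
Qed.

(** Positivity makes every term negative, hence at most -2 in a minimal
    sequence; then v increases at each step and cannot come back to 1. *)
Lemma unimod_minimal u v X : 0 <= u < v -> minimal X -> unimod u v X -> X = [::] /\ v = 1.
Proof.
elim: X u v => [|x X IH] u v /= /andP[u0 uv]; first by move=> _ /eqP.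
rewrite /minimal inE negb_or => /andP[x1 mX] /andP[d0 h].
have x0 : x < 0.
  by rewrite ltNge; apply/negP => x0; have := mulr_ge0 x0 (le_trans u0 (ltW uv)); lia.
have xv : (- 2 - x) * v >= 0 by apply: mulr_ge0; lia.
by have [|_ ?] := IH v (- x * v - u) _ mX h; lia.
Qed.

Lemma leZ_equivZ V W : leZ V W -> equivZ W V.
Proof.
move=> h; apply: rst_sym; elim: h => {V W} [U V b|U|U V W _ h1 _ h2].
- exact: rst_step.
- exact: rst_refl.
- exact: rst_trans h1 h2.
Qed.

Lemma equivZ_nil_leZ X : equivZ X [::] -> leZ [::] X.
Proof.
move=> eX; have [Z [mZ leX]] := leZ_minimal X.
suff [<- _] : Z = [::] /\ 1 = 1 :> int by [].
apply: (@unimod_minimal 0) => //; have -> // : unimod 0 1 Z = true.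
by rewrite -(unimod_equivZ (leZ_equivZ leX)) (unimod_equivZ eX).
Qed.

(** * Locating the single term -1 *)

Lemma one_sided l r W A m B : contracts l r W (A ++ m :: B) -> count_mem (-1) W = 1%N ->
  (exists d A', W = A' ++ m + d :: B /\ contracts l true (A' ++ [:: m + d]) (A ++ [:: m])) \/
  (exists e B', W = A ++ m + e :: B' /\ contracts true r (m + e :: B') (m :: B)).
Proof.
case/contracts_split => A' [d [e [B' [-> _ cA' cB']]]] ct.
have [[eA ed]|inA] := left_grown cA'.
  by right; exists e, B'; rewrite eA ed addr0.
have [[eB ee]|inB] := right_grown cB'.
  by left; exists d, A'; rewrite eB ee addr0.
move: inA inB ct; rewrite -!has_pred1 !has_count count_cat /=.
by case: (count _ A') (count _ B') => [|a] [|b] //; rewrite addSn !addnS.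
Qed.

(** The walk along M: once nothing happens to the left of m, either everything
    happens to the left of the next term, or nothing does and the walk goes on. *)
Lemma gap_of_suffix W m B : contracts true false W (m :: B) ->
  minimal (m :: B) -> count_mem (-1) W = 1%N ->
  let M := m :: B in
  (exists i U, [/\ (i.+1 < size M)%N, W = take i M ++ U ++ drop i.+2 M &
     contracts true true U [:: M`_i; M`_i.+1]]) \/
  (exists U, W = take (size M).-1 M ++ U /\
     contracts true false U [:: M`_(size M).-1]).
Proof.
elim: B m W => [|m2 B IH] m W cW mM ct /=; first by right; exists W.
have [[d [A' [eW cA]]]|[e [B' [eW cB]]]] := one_sided (A := [:: m]) cW ct.
  by left; exists 0%N, (A' ++ [:: m2 + d]); split; rewrite // drop0 -catA.
move: mM; rewrite /minimal inE negb_or eq_sym => /andP[/negPf m1 mB].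
move: ct; rewrite eW /= m1 add0n => ct.
have [[i [U [lti -> cU]]]|[U [-> cU]]] := IH _ _ cB mB ct.
  by left; exists i.+1, U; split.
by right; exists U.
Qed.

Lemma gap_of_leZ M W : M <> [::] -> minimal M -> leZ M W -> count_mem (-1) W = 1%N ->
  [\/ exists U, W = U ++ behead M /\ contracts false true U [:: M`_0],
      exists i U, [/\ (i.+1 < size M)%N, W = take i M ++ U ++ drop i.+2 M &
        contracts true true U [:: M`_i; M`_i.+1]] |
      exists U, W = take (size M).-1 M ++ U /\
        contracts true false U [:: M`_(size M).-1]].
Proof.
case: M => [//|m B] _ mM /contracts_leZ cW ct.
have [[d [A' [eW cA]]]|[e [B' [eW cB]]]] := one_sided (A := [::]) cW ct.
  by constructor 1; exists (A' ++ [:: m + d]); rewrite -catA.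
by rewrite eW in ct *; case: (gap_of_suffix cB mM ct) => H; [constructor 2|constructor 3].
Qed.

(** * The sets E_, E_right, E_left and E_both *)

Lemma count_mem_pivot (T : eqType) (z : T) P Q :
  (count_mem z (P ++ z :: Q) == 1%N) = (z \notin P) && (z \notin Q).
Proof.
by rewrite count_cat /= eqxx add1n addnS eqSS addn_eq0 -!(sameP count_memPn eqP).
Qed.

Lemma negative_minimal X : all (fun z => z < 0) X -> minimal X -> all (fun z => z <= -2) X.
Proof.
move=> /allP neg mX; apply/allP => z zX; have := neg z zX.
have : z != -1 by apply: contraNneq mX => <-.
by lia.
Qed.

Lemma inNstarE X : inNstar X = all (fun z => z <= -2) X.
Proof. by apply: eq_all => z; lia. Qed.

Lemma inM_minimal X : inM X -> minimal X.
Proof.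
case: X => //= x X /andP[x1 /allP h]; rewrite /minimal inE negb_or eq_sym x1 /=.
by apply/negP => /h.
Qed.

Lemma inMrev_minimal Y : inMrev Y -> minimal Y.
Proof. by move/inM_minimal; rewrite /minimal mem_rev. Qed.

Lemma inNstar_minimal X : inNstar X -> minimal X.
Proof. by move/allP => h; apply/negP => /h. Qed.

Lemma pivot_uniq (T : eqType) (z : T) P Q P' Q' : z \notin P -> z \notin P' ->
  P ++ z :: Q = P' ++ z :: Q' -> P = P' /\ Q = Q'.
Proof. by move=> h h' /eqP; rewrite eqseq_pivot2l // => /andP[/eqP-> /eqP->]. Qed.

Lemma pivot_left X Y a B : minimal X -> minimal Y ->
  X ++ -1 :: Y = a :: B -> -1 \in B ->
  exists X', [/\ X = a :: X', a != -1, minimal X' & B = X' ++ -1 :: Y].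
Proof.
rewrite /minimal => mX mY; case: X mX => [|x X'] mX /= [ea <-].
  by rewrite (negPf mY).
by move: mX; rewrite -ea inE negb_or eq_sym => /andP[x1 mX'] _; exists X'.
Qed.

Lemma pivot_right X Y A b : minimal X -> minimal Y ->
  X ++ -1 :: Y = A ++ [:: b] -> -1 \in A ->
  exists Y', [/\ Y = Y' ++ [:: b], b != -1, minimal Y' & A = X ++ -1 :: Y'].
Proof.
move=> mX; case/lastP: Y => [|Y' y] mY /eqP.
  by rewrite !cats1 eqseq_rcons => /andP[/eqP<-]; rewrite (negPf mX).
move: mY; rewrite /minimal mem_rcons inE negb_or eq_sym => /andP[y1 mY'].
rewrite -rcons_cons -rcons_cat cats1 eqseq_rcons => /andP[/eqP<- /eqP<-] _.
by exists Y'; rewrite cats1.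
Qed.

Lemma pivot_not_minimal X Y V : X ++ -1 :: Y = V -> minimal V -> False.
Proof. by move=> <-; rewrite /minimal mem_cat inE eqxx orbT. Qed.

Lemma cluster_negative X Y : minimal X -> minimal Y ->
  contracts false false (X ++ -1 :: Y) [::] -> inNstar X /\ inNstar Y.
Proof.
move=> mX mY /contracts_leZ/leZ_nil_negative; rewrite all_cat /= => /andP[nX nY].
by rewrite !inNstarE !negative_minimal.
Qed.

Lemma E_iff X Y : E_ X Y <-> [/\ minimal X, minimal Y & leZ [::] (X ++ -1 :: Y)].
Proof.
split=> [[nX nY e]|[mX mY le]].
  by split; [exact: inNstar_minimal|exact: inNstar_minimal|exact: equivZ_nil_leZ].
have [|nX nY] := cluster_negative mX mY; first exact/contracts_leZ.
by split=> //; exact: leZ_equivZ.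
Qed.

Lemma inM_cons a X : a != -1 -> inNstar X -> inM (a :: X).
Proof. by rewrite inNstarE /= => -> ->. Qed.

Lemma inMrev_rcons b Y : b != -1 -> inNstar Y -> inMrev (Y ++ [:: b]).
Proof. by rewrite inNstarE /inMrev cats1 rev_rcons /= all_rev => -> ->. Qed.

(** The membership conditions on X and Y in the definition of the sets can be
    replaced by the absence of -1: the other inequalities follow from the
    contraction, once the protected terms are peeled off. *)
Lemma E_right_iff b X Y : b != -1 ->
  E_right b X Y <-> [/\ minimal X, minimal Y & contracts false true (X ++ -1 :: Y) [:: b]].
Proof.
move=> b1; split=> [[/inNstar_minimal ? /inMrev_minimal ? ?]|[mX mY cW]]; first by [].
have [A [c [eW cA inA]]] := peel_right (A := [::]) cW.
case: inA => [/pivot_not_minimal[]|inA]; first by rewrite /minimal inE eq_sym.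
have [Y' [eY c1 mY' eA]] := pivot_right mX mY eW inA.
have [|nX nY'] := cluster_negative mX mY'; first by rewrite -eA.
by split; rewrite // eY inMrev_rcons.
Qed.

Lemma E_left_iff a X Y : a != -1 ->
  E_left a X Y <-> [/\ minimal X, minimal Y & contracts true false (X ++ -1 :: Y) [:: a]].
Proof.
move=> a1; split=> [[/inM_minimal ? /inNstar_minimal ? ?]|[mX mY cW]]; first by [].
have [c [B [eW cB inB]]] := peel_left cW.
case: inB => [/pivot_not_minimal[]|inB]; first by rewrite /minimal inE eq_sym.
have [X' [eX c1 mX' eB]] := pivot_left mX mY eW inB.
have [|nX' nY] := cluster_negative mX' mY; first by rewrite -eB.
by split; rewrite // eX inM_cons.
Qed.

Lemma E_both_iff a b X Y : a != -1 -> b != -1 ->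
  E_both a b X Y <-> [/\ minimal X, minimal Y & contracts true true (X ++ -1 :: Y) [:: a; b]].
Proof.
move=> a1 b1; split=> [[/inM_minimal ? /inMrev_minimal ? ?]|[mX mY cW]]; first by [].
have [c [B [eW cB inB]]] := peel_left cW.
case: inB => [/pivot_not_minimal[]|inB].
  by rewrite /minimal !inE negb_or !(eq_sym (-1)) a1.
have [X' [eX c1 mX' eB]] := pivot_left mX mY eW inB.
have [A [d [eW' cA inA]]] := peel_right (A := [::]) cB.
rewrite eB in eW' inA.
case: inA => [/pivot_not_minimal[]|inA]; first by rewrite /minimal inE eq_sym.
have [Y' [eY d1 mY' eA]] := pivot_right mX' mY eW' inA.
have [|nX' nY'] := cluster_negative mX' mY'; first by rewrite -eA.
by split; rewrite // ?eX ?eY ?inM_cons ?inMrev_rcons.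
Qed.

Lemma nth_minimal M i : minimal M -> (i < size M)%N -> M`_i != -1.
Proof. by move=> mM lti; apply: contraNneq mM => <-; exact: mem_nth. Qed.

Lemma minimal_cat A B : minimal (A ++ B) <-> minimal A /\ minimal B.
Proof. by rewrite /minimal mem_cat negb_or; split=> /andP. Qed.

Lemma minimal_take i M : minimal M -> minimal (take i M).
Proof. by apply: contra => /mem_take. Qed.

Lemma minimal_drop i M : minimal M -> minimal (drop i M).
Proof. by apply: contra => /mem_drop. Qed.

(** * The fourth family *)

Lemma locate_pivot A U B P Q : minimal A -> minimal B -> minimal P -> minimal Q ->
  P ++ -1 :: Q = A ++ U ++ B ->
  exists X Y, [/\ U = X ++ -1 :: Y, P = A ++ X, Q = Y ++ B, minimal X & minimal Y].
Proof.
move=> mA mB mP mQ e.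
have inU : -1 \in U.
  have : -1 \in A ++ U ++ B by rewrite -e mem_cat inE eqxx orbT.
  by rewrite !mem_cat (negPf mA) (negPf mB) orbF.
have eU := cat_take_drop (index (-1) U) U.
rewrite (drop_nth 0) ?index_mem // nth_index // in eU.
set X := take _ _ in eU; set Y := drop _ _ in eU; exists X, Y.
have mX : minimal X.
  by rewrite /minimal /X; apply/negP => /index_ltn; rewrite ltnn.
move: e; rewrite -eU -catA cat_cons catA => /(pivot_uniq mP) [|eP eQ].
  exact/minimal_cat.
by move: mQ; rewrite eQ => /minimal_cat[].
Qed.

Lemma leZ_pivot M P Q : M <> [::] -> minimal M ->
  [/\ minimal P, minimal Q & leZ M (P ++ -1 :: Q)] <->
  [\/ exists X Y, [/\ E_right M`_0 X Y, P = X & Q = Y ++ behead M],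
      exists i X Y, [/\ (i.+1 < size M)%N, E_both M`_i M`_i.+1 X Y,
        P = take i M ++ X & Q = Y ++ drop i.+2 M] |
      exists X Y, [/\ E_left M`_(size M).-1 X Y,
        P = take (size M).-1 M ++ X & Q = Y]].
Proof.
move=> M0 mM; have sM : (0 < size M)%N by case: M M0 {mM}.
have ltM : ((size M).-1 < size M)%N by rewrite prednK.
have n1 i : (i < size M)%N -> M`_i != -1 by exact: nth_minimal.
have mB : minimal (behead M) by rewrite -drop1; exact: minimal_drop.
split=> [[mP mQ le]|].
  have ct : count_mem (-1) (P ++ -1 :: Q) = 1%N.
    by apply/eqP; rewrite count_mem_pivot mP.
  case: (gap_of_leZ M0 mM le ct) => [[U [eW cU]]|[i [U [lti eW cU]]]|[U [eW cU]]].
  - have [X [Y [eU -> -> mX mY]]] := locate_pivot (A := [::]) isT mB mP mQ eW.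
    by constructor 1; exists X, Y; split=> //; apply/E_right_iff; rewrite ?n1 -?eU.
  - have [X [Y [eU -> -> mX mY]]] :=
      locate_pivot (minimal_take i mM) (minimal_drop i.+2 mM) mP mQ eW.
    constructor 2; exists i, X, Y; split=> //.
    by apply/E_both_iff; rewrite ?n1 -?eU // ltnW.
  - rewrite -[U]cats0 in eW.
    have [X [Y [eU -> -> mX mY]]] :=
      locate_pivot (minimal_take _ mM) (isT : minimal [::]) mP mQ eW.
    rewrite cats0; constructor 3; exists X, Y; split=> //.
    by apply/E_left_iff; rewrite ?n1 -?eU.
case=> [[X [Y [/E_right_iff hE -> ->]]]|[i [X [Y [lti /E_both_iff hE -> ->]]]]
       |[X [Y [/E_left_iff hE -> ->]]]].
- have [mX mY cU] := hE (n1 _ sM).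
  split=> //; first exact/minimal_cat.
  have := contracts_in_context (A := [::]) (B := behead M) cU.
  have -> : [::] ++ [:: M`_0] ++ behead M = M by case: M M0 {mM sM ltM n1 mB hE cU}.
  by rewrite -catA; apply; [right|left].
- have [mX mY cU] := hE (n1 _ (ltnW lti)) (n1 _ lti).
  split; [by apply/minimal_cat; split=> //; exact: minimal_take
         |by apply/minimal_cat; split=> //; exact: minimal_drop|].
  have := contracts_in_context (A := take i M) (B := drop i.+2 M) cU.
  have -> : take i M ++ [:: M`_i; M`_i.+1] ++ drop i.+2 M = M.
    by rewrite /= -!drop_nth ?cat_take_drop // ltnW.
  by rewrite -!catA; apply; left.
- have [mX mY cU] := hE (n1 _ ltM).
  split=> //; first by apply/minimal_cat; split=> //; exact: minimal_take.
  have := contracts_in_context (A := take (size M).-1 M) (B := [::]) cU.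
  have -> : take (size M).-1 M ++ [:: M`_(size M).-1] ++ [::] = M.
    rewrite -[RHS](cat_take_drop (size M).-1) (drop_nth 0) // prednK //.
    by rewrite drop_size.
  by rewrite cats0 -!catA; apply; [left|right].
Qed.

(** * Description of the elements of oplus *)

Lemma leZ_into_minimal W X : minimal X -> leZ W X -> W = X.
Proof.
by move=> /negPf mX /contracts_leZ/contracts_refl_or_mem; rewrite mX => -[->|].
Qed.

Lemma is_min_below_minimal X Z : minimal X -> is_min_below X Z <-> Z = X.
Proof.
move=> mX; split=> [[[mZ /leZ_into_minimal->//]]|->].
split; first by split=> //; exact: rt_refl.
by move=> W [_ /leZ_into_minimal->].
Qed.

Lemma is_min_below_eq X W Z : (exists V, is_min_below X V) -> minimal W -> leZ W X ->
  is_min_below X Z <-> Z = W.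
Proof.
move=> [V [hV uV]] mW le; have eV := uV W (conj mW le); rewrite eV in hV uV.
by split=> [[hZ _]|->]; [rewrite (uV Z hZ)|split].
Qed.

(** Only the parameters x = -1 or y = -1 in the first three families leave
    something to blow down. *)
Lemma oplusE M Z : minimal M -> oplus M Z <->
  (exists x : int, x <> -1 /\ Z = [:: 0, x & M]) \/
  is_min_below [:: 0, -1 & M] Z \/
  (exists x : int, x <> -1 /\ Z = M ++ [:: x; 0]) \/
  is_min_below (M ++ [:: -1; 0]) Z \/
  (exists j : nat, (j < size M)%N /\
     ((exists x y : int, x <> -1 /\ y <> -1 /\ x + y = M`_j /\
         Z = take j M ++ [:: x; 0; y] ++ drop j.+1 M) \/
      is_min_below (take j M ++ [:: -1; 0; M`_j + 1] ++ drop j.+1 M) Z \/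
      is_min_below (take j M ++ [:: M`_j + 1; 0; -1] ++ drop j.+1 M) Z)) \/
  (exists (P Q : seq int) (x y : int),
     [/\ minimal P, minimal Q & leZ M (P ++ -1 :: Q)] /\
     x <> -1 /\ y <> -1 /\ x + y = -1 /\ Z = P ++ [:: x; 0; y] ++ Q).
Proof.
move=> mM.
have mL x : x <> -1 -> minimal [:: 0, x & M].
  by move=> /eqP x1; rewrite /minimal !inE !(eq_sym (-1)) (negPf x1).
have mR x : x <> -1 -> minimal (M ++ [:: x; 0]).
  move=> /eqP x1; apply/minimal_cat; split=> //.
  by rewrite /minimal !inE !(eq_sym (-1)) (negPf x1).
have mI j x y : x <> -1 -> y <> -1 -> minimal (take j M ++ [:: x; 0; y] ++ drop j.+1 M).
  move=> /eqP x1 /eqP y1; apply/minimal_cat; split; first exact: minimal_take.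
  apply/minimal_cat; split; last exact: minimal_drop.
  by rewrite /minimal !inE !(eq_sym (-1)) (negPf x1) (negPf y1).
split.
- case=> [x V|x V|j x y V ltj exy|M' j x y le ct ltj ej x1 y1 exy].
  + have [->|/eqP x1] := eqVneq x (-1); first by right; left.
    by move/(is_min_below_minimal _ (mL x x1)) => ->; left; exists x.
  + have [->|/eqP x1] := eqVneq x (-1); first by right; right; right; left.
    by move/(is_min_below_minimal _ (mR x x1)) => ->; right; right; left; exists x.
  + move=> hV; do 4!right; left; exists j; split=> //.
    have [ex|/eqP x1] := eqVneq x (-1).
      have ey : y = M`_j + 1 by rewrite -exy ex; ring.
      by right; left; move: hV; rewrite ex ey.
    have [ey|/eqP y1] := eqVneq y (-1).
      have ex : x = M`_j + 1 by rewrite -exy ey; ring.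
      by right; right; move: hV; rewrite ex ey.
    left; exists x, y; do 3!split=> //.
    exact/(is_min_below_minimal _ (mI j x y x1 y1)).
  + have eM' : M' = take j M' ++ -1 :: drop j.+1 M'.
      by rewrite -ej -drop_nth // cat_take_drop.
    do 5!right; exists (take j M'), (drop j.+1 M'), x, y; split.
      rewrite -eM'; split=> //; move/eqP: ct;
      by rewrite {1}eM' count_mem_pivot => /andP[].
    by split; [exact/eqP|split; first exact/eqP].
- case=> [[x [x1 ->]]|[hV|[[x [x1 ->]]|[hV|[[j [ltj hV]]|hV]]]]].
  + by apply: (oplus1 (x := x)); exact/(is_min_below_minimal _ (mL x x1)).
  + exact: (oplus1 (x := -1)).
  + by apply: (oplus2 (x := x)); exact/(is_min_below_minimal _ (mR x x1)).
  + exact: (oplus2 (x := -1)).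
  + case: hV => [[x [y [x1 [y1 [exy ->]]]]]|[hV|hV]].
    * by apply: (oplus3 ltj exy); exact/(is_min_below_minimal _ (mI j x y x1 y1)).
    * by apply: (oplus3 (x := -1) ltj _ hV); ring.
    * by apply: (oplus3 (y := -1) ltj _ hV); ring.
  + case: hV => P [Q [x [y [[mP mQ le] [/eqP x1 [/eqP y1 [exy ->]]]]]]].
    have := oplus4 (j := size P) le _ _ _ x1 y1 exy.
    rewrite /addI take_size_cat // -cat_rcons drop_size_cat ?size_rcons //.
    apply; first by apply/eqP; rewrite cat_rcons count_mem_pivot mP.
      by rewrite size_cat size_rcons; lia.
    by rewrite cat_rcons nth_cat ltnn subnn.
Qed.

Theorem proposition7p5 :
  (forall Z : seq int, oplus [::] Z <->
     (Z = [:: 1]) \/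
     (exists x : int, x <> -1 /\ Z = [:: 0; x]) \/
     (exists x : int, x <> -1 /\ Z = [:: x; 0]) \/
     (exists (X Y : seq int) (x y : int),
        E_ X Y /\ x <> -1 /\ y <> -1 /\ x + y = -1 /\
        Z = X ++ [:: x; 0; y] ++ Y))
  /\
  (forall M : seq int, M <> [::] -> minimal M ->
   forall Z : seq int, oplus M Z <->
     (* (1) *)
     (exists x : int, x <> -1 /\ Z = [:: 0, x & M]) \/
     is_min_below [:: 0, -1 & M] Z \/
     (* (2) *)
     (exists x : int, x <> -1 /\ Z = M ++ [:: x; 0]) \/
     is_min_below (M ++ [:: -1; 0]) Z \/
     (* (3) *)
     (exists j : nat, (j < size M)%N /\
        ((exists x y : int, x <> -1 /\ y <> -1 /\ x + y = M`_j /\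
            Z = take j M ++ [:: x; 0; y] ++ drop j.+1 M) \/
         is_min_below (take j M ++ [:: -1; 0; M`_j + 1] ++ drop j.+1 M) Z \/
         is_min_below (take j M ++ [:: M`_j + 1; 0; -1] ++ drop j.+1 M) Z)) \/
     (* (4) *)
     (exists (X Y : seq int) (x y : int),
        x <> -1 /\ y <> -1 /\ x + y = -1 /\ E_right M`_0 X Y /\
        Z = X ++ [:: x; 0; y] ++ Y ++ behead M) \/
     (exists (i : nat) (X Y : seq int) (x y : int),
        (i.+1 < size M)%N /\
        x <> -1 /\ y <> -1 /\ x + y = -1 /\ E_both M`_i M`_i.+1 X Y /\
        Z = take i M ++ X ++ [:: x; 0; y] ++ Y ++ drop i.+2 M) \/
     (exists (X Y : seq int) (x y : int),
        x <> -1 /\ y <> -1 /\ x + y = -1 /\ E_left M`_(size M).-1 X Y /\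
        Z = take (size M).-1 M ++ X ++ [:: x; 0; y] ++ Y)).
Proof.
split=> [Z|M M0 mM Z].
- have m0 : minimal [::] by [].
  have mL : is_min_below [:: 0; -1] Z <-> Z = [:: 1].
    apply: is_min_below_eq => //; first exact: (min_below_L (-1) m0).
    by apply: rt_step; exists 1%N; exact: (blowup_right [::] 1).
  have mR : is_min_below [:: -1; 0] Z <-> Z = [:: 1].
    apply: is_min_below_eq => //; first exact: (min_below_R (-1) m0).
    by apply: rt_step; exists 0%N; exact: (blowup_left 1 [::]).
  rewrite (oplusE Z m0) mL mR; split.
    case=> [?|[?|[?|[?|[[? []//]|[P [Q [x [y [/E_iff EPQ ?]]]]]]]]]];
      [by right; left|by left|by right; right; left|by left|].
    by do 3!right; exists P, Q, x, y.
  case=> [?|[?|[?|[X [Y [x [y [/E_iff EXY ?]]]]]]]];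
    [by right; left|by left|by right; right; left|].
  by do 5!right; exists X, Y, x, y.
- have h P Q := leZ_pivot P Q M0 mM.
  rewrite (oplusE Z mM); split.
    case=> [?|[?|[?|[?|[?|[P [Q [x [y [/h le [x1 [y1 [exy ->]]]]]]]]]]]]];
      [by left|by right; left|by do 2!right; left|by do 3!right; left|by do 4!right; left|].
    do 5!right; case: le => [[X [Y [hE -> ->]]]|[i [X [Y [lti hE -> ->]]]]|[X [Y [hE -> ->]]]].
    + by left; exists X, Y, x, y.
    + by right; left; exists i, X, Y, x, y; rewrite -catA.
    + by right; right; exists X, Y, x, y; rewrite -catA.
  case=> [?|[?|[?|[?|[?|H]]]]];
    [by left|by right; left|by do 2!right; left|by do 3!right; left|by do 4!right; left|].
  do 5!right.
  case: H => [[X [Y [x [y [x1 [y1 [exy [hE ->]]]]]]]]|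
             [[i [X [Y [x [y [lti [x1 [y1 [exy [hE ->]]]]]]]]]]|
             [X [Y [x [y [x1 [y1 [exy [hE ->]]]]]]]]]].
  + exists X, (Y ++ behead M), x, y; split=> //.
    by apply/h; constructor 1; exists X, Y.
  + exists (take i M ++ X), (Y ++ drop i.+2 M), x, y; split; last by rewrite -catA.
    by apply/h; constructor 2; exists i, X, Y.
  + exists (take (size M).-1 M ++ X), Y, x, y; split; last by rewrite -catA.
    by apply/h; constructor 3; exists X, Y.
Qed.
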